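(* Let $G$ be a finite simple connected edge transitive graph. If $\lambda$ is an eigenvalue of the normalized Laplacian $\mathcal{L}$ of $G$, then $\dfrac{d\lambda}{de}=0$ for every edge $e$ of $G$.
   Context: A graph is edge transitive if for every pair of edges $e_1,e_2$ there is a graph automorphism mapping $e_1$ to $e_2$. For a finite simple connected graph $G$ with at least two vertices, $A$ is the adjacency matrix, $d_x$ is the degree of the vertex $x$, $D$ is the diagonal matrix of degrees (invertible), and the normalized Laplacian is $\mathcal{L} = I - D^{-1/2} A D^{-1/2}$. Edge derivative: let $\lambda$ be an eigenvalue of $\mathcal{L}$ of multiplicity $k$, let $\mathbf{v}_1,\dots,\mathbf{v}_k$ be an orthonormal basis of the $\lambda$-eigenspace, and write $\mathbf{v}_{i,x}$ for the entry of $\mathbf{v}_i$ at the vertex $x$. For a pair $e=\{x,y\}$ of distinct vertices (adjacent or not), $$\frac{d\lambda}{de}=\frac{d\lambda}{d\{x,y\}} = \frac1k\sum_{i=1}^k\left[(1-\lambda)\left(\frac{\mathbf{v}_{i,x}^2}{d_x}+\frac{\mathbf{v}_{i,y}^2}{d_y}\right)-2\,\frac{\mathbf{v}_{i,x}\mathbf{v}_{i,y}}{\sqrt{d_xd_y}}\right].$$ This value does not depend on the choice of the orthonormal basis. (It is the average over $i$ of $\mathbf{v}_i^T \mathcal{L}'(0)\mathbf{v}_i$, where $\mathcal{L}(t)$ is the normalized Laplacian of the weighted graph obtained from $G$ by adding $t$ to the weight of the pair $\{x,y\}$, edges having weight 1 and non-edges weight 0.) *)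

(* Defs.v *)
From mathcomp Require Import all_boot all_order all_fingroup all_algebra.

Set Implicit Arguments.
Unset Strict Implicit.
Unset Printing Implicit Defensive.

Import GRing.Theory Num.Theory.
Local Open Scope ring_scope.

(* A graph is given by its adjacency relation [e] on a finite vertex type [T];
   it is simple when [e] is symmetric and irreflexive. *)

Definition graph_connected (T : finType) (e : rel T) : Prop :=
  forall x y : T, connect e x y.

Definition graph_automorphism (T : finType) (e : rel T) (p : {perm T}) : Prop :=
  forall x y : T, e (p x) (p y) = e x y.

(* Edges are unordered pairs, so the automorphism may exchange the ends. *)
Definition edge_transitive (T : finType) (e : rel T) : Prop :=
  forall x1 y1 x2 y2 : T, e x1 y1 -> e x2 y2 ->
    exists2 p : {perm T},
      graph_automorphism e p & p @: [set x1; y1] = [set x2; y2].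

Definition degree (T : finType) (e : rel T) (x : T) : nat :=
  #|[set y | e x y]|.

(* Rows and columns are indexed by ['I_#|T|]: the vertex [x] has index
   [enum_rank x], and the index [i] stands for the vertex [enum_val i]. *)
Definition adjacency_mx (R : rcfType) (T : finType) (e : rel T) :
    'M[R]_#|T| :=
  \matrix_(i, j) (e (enum_val i) (enum_val j))%:R.

Definition inv_sqrt_degree_mx (R : rcfType) (T : finType) (e : rel T) :
    'M[R]_#|T| :=
  diag_mx (\row_i (Num.sqrt (degree e (enum_val i))%:R)^-1).

Definition normalized_laplacian (R : rcfType) (T : finType) (e : rel T) :
    'M[R]_#|T| :=
  1%:M - inv_sqrt_degree_mx R e *m adjacency_mx R e *m inv_sqrt_degree_mx R e.

(* The normalized Laplacian is symmetric, so the row eigenvectors used by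
   [eigenvalue] and [eigenspace] are the transposes of the column eigenvectors,
   and the geometric multiplicity below is also the algebraic one. *)
Definition multiplicity (R : rcfType) (n : nat) (M : 'M[R]_n) (lambda : R) :
    nat :=
  \rank (eigenspace M lambda).

(* The basis vectors are the rows of [V]. *)
Definition orthonormal_eigenbasis (R : rcfType) (n k : nat) (M : 'M[R]_n)
    (lambda : R) (V : 'M[R]_(k, n)) : Prop :=
  V *m V^T = 1%:M /\ (V == eigenspace M lambda)%MS.

(* [V i (enum_rank x)] is the entry at the vertex [x] of the [i]-th vector of
   the orthonormal basis [V] of the [lambda]-eigenspace; the value does not
   depend on the choice of such a [V]. *)
Definition edge_derivative (R : rcfType) (T : finType) (e : rel T) (lambda : R)
    (k : nat) (V : 'M[R]_(k, #|T|)) (x y : T) : R :=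
  k%:R^-1 *
  \sum_(i < k)
    ((1 - lambda) * (V i (enum_rank x) ^+ 2 / (degree e x)%:R
                     + V i (enum_rank y) ^+ 2 / (degree e y)%:R)
     - 2 * (V i (enum_rank x) * V i (enum_rank y)
            / Num.sqrt ((degree e x)%:R * (degree e y)%:R))).

(* Main.v *)
Require Import Defs.
From mathcomp Require Import all_boot all_order all_fingroup all_algebra.
From mathcomp Require Import ring.

(* The derivative along an edge only depends on the orthogonal projector
   [V^T *m V] onto the eigenspace, which is invariant under automorphisms; hence
   it takes the same value on all edges of an edge transitive graph. In its sum
   over all ordered edges, each unit eigenvector contributes [2 (1 - lambda)]
   through the squares and, by the eigenvector equation, [- 2 (1 - lambda)]
   through the mixed products, so that the common value is zero. *)

Set Implicit Arguments.
Unset Strict Implicit.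
Unset Printing Implicit Defensive.

Import GRing.Theory Num.Theory.
Local Open Scope ring_scope.

(** A path from [x] to some other vertex has to leave [x] through a neighbour. *)
Lemma degree_gt0 (T : finType) (e : rel T) (x : T) :
  (1 < #|T|)%N -> graph_connected e -> (0 < degree e x)%N.
Proof.
move=> card_T e_conn; have /pred0Pn[y /= y_neq_x] : ~~ pred0b (predC1 x).
  by rewrite -lt0n cardC1 -ltnS prednK // ltnW.
case/connectP: (e_conn x y) => [[|z p]] /=.
  by move=> _ yx; rewrite yx eqxx in y_neq_x.
by case/andP=> exz _ _; apply/card_gt0P; exists z; rewrite inE.
Qed.

Lemma degree_automorphism (T : finType) (e : rel T) (p : {perm T}) (x : T) :
  graph_automorphism e p -> degree e (p x) = degree e x.
Proof.
move=> p_aut; rewrite /degree -[RHS](card_imset _ (@perm_inj _ p)); apply: eq_card => y.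
by rewrite -[y](permKV p) inE p_aut (mem_imset _ _ (@perm_inj _ p)) inE.
Qed.

(** Writing [W = A *m V] with [A] square, both orthonormality relations give [A *m A^T = 1]. Hence
    [A^T *m A = 1], and this factor cancels in the Gram matrix of [W]. *)
Lemma gram_rotation (R : fieldType) (k n : nat) (V W : 'M[R]_(k, n)) :
  V *m V^T = 1%:M -> W *m W^T = 1%:M -> (W <= V)%MS -> W^T *m W = V^T *m V.
Proof.
move=> VV WW /submxP[A defW].
have AA : A^T *m A = 1%:M.
  by apply: mulmx1C; rewrite -WW defW trmx_mul mulmxA -(mulmxA A) VV mulmx1.
by rewrite defW trmx_mul -mulmxA [A^T *m _]mulmxA AA mul1mx.
Qed.

(** As [M] commutes with the permutation of coordinates by [s], permuting the entries of the basis
    vectors gives another orthonormal family in the same eigenspace. *)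
Lemma gram_col_perm (R : rcfType) (k n : nat) (M : 'M[R]_n) (lambda : R)
    (V : 'M[R]_(k, n)) (s : {perm 'I_n}) :
  row_perm s (col_perm s M) = M -> orthonormal_eigenbasis M lambda V ->
  (col_perm s V)^T *m col_perm s V = V^T *m V.
Proof.
move=> sM [VV /andP[VM MV]]; apply: gram_rotation => //.
  by rewrite tr_col_perm mul_col_perm -row_permM mulVg row_perm1.
apply: submx_trans MV; apply/eigenspaceP; move/eigenspaceP: VM => VM.
(* With [M] written as its conjugate, its row permutation cancels the column permutation of [V]. *)
rewrite -{1}sM mul_col_perm -row_permM mulVg row_perm1.
by rewrite col_permE mulmxA VM -scalemxAl -col_permE.
Qed.

Section Laplacian.

Variables (R : rcfType) (T : finType) (e : rel T).
Local Notation L := (normalized_laplacian R e).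
Local Notation d x := ((degree e x)%:R : R).

Lemma normalized_laplacianE (x y : T) :
  L (enum_rank x) (enum_rank y) =
    (x == y)%:R - (e x y)%:R / Num.sqrt (d x * d y).
Proof.
rewrite !mxE (inj_eq enum_rank_inj); congr (_ - _).
rewrite (bigD1 (enum_rank y)) //= big1 => [|j j_neq_y]; last first.
  by rewrite !mxE (negPf j_neq_y) mulr0n mulr0.
rewrite addr0 !mxE (bigD1 (enum_rank x)) //= big1 => [|j j_neq_x]; last first.
  by rewrite !mxE eq_sym (negPf j_neq_x) mulr0n mul0r.
rewrite addr0 !mxE !eqxx !enum_rankK !mulr1n sqrtrM ?ler0n // invfM.
by rewrite mulrCA mulrA.
Qed.

(** This is the eigenvector equation read at the coordinate [x], with the diagonal entry 1 of the
    Laplacian moved to the other side. *)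
Lemma sum_neighbours_eigenvector (e_sym : symmetric e) (lambda : R) (k : nat)
    (V : 'M[R]_(k, #|T|)) (i : 'I_k) (x : T) :
  V *m L = lambda *: V ->
  \sum_(y | e x y) V i (enum_rank y) / Num.sqrt (d x * d y) =
    (1 - lambda) * V i (enum_rank x).
Proof.
move/matrixP/(_ i (enum_rank x)); rewrite !mxE.
rewrite (reindex (@enum_rank T)) /=; last exact: onW_bij (@enum_rank_bij T).
under eq_bigr => y _ do rewrite normalized_laplacianE mulrBr.
rewrite sumrB (bigD1 x) //= eqxx mulr1 big1 => [|y /negPf->]; last by rewrite mulr0.
rewrite addr0 mulrBl mul1r => <-; rewrite opprB addrCA subrr addr0.
rewrite big_mkcond /=; apply: eq_bigr => y _.
by rewrite e_sym [d x * _]mulrC; case: (e y x); rewrite ?mul1r // mul0r mulr0.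
Qed.

Lemma edge_derivativeC (lambda : R) (k : nat) (V : 'M[R]_(k, #|T|)) (x y : T) :
  edge_derivative e lambda V x y = edge_derivative e lambda V y x.
Proof.
rewrite /edge_derivative; congr (_ * _); apply: eq_bigr => i _.
by rewrite addrC [d x * _]mulrC [V i (enum_rank x) * _]mulrC addrC [_ / d x + _]addrC.
Qed.

Lemma edge_derivativeE (lambda : R) (k : nat) (V : 'M[R]_(k, #|T|)) (x y : T) :
  let P := V^T *m V in
  edge_derivative e lambda V x y = k%:R^-1 *
    ((1 - lambda) * (P (enum_rank x) (enum_rank x) / d x
                     + P (enum_rank y) (enum_rank y) / d y)
     - 2 * (P (enum_rank x) (enum_rank y) / Num.sqrt (d x * d y))).
Proof.
rewrite /edge_derivative /= !mxE; congr (_ * _).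
rewrite !mulr_suml -big_split /= !mulr_sumr -sumrB.
by apply: eq_bigr => i _; rewrite !mxE !expr2.
Qed.

Lemma edge_derivative_automorphism (lambda : R) (k : nat)
    (V : 'M[R]_(k, #|T|)) (p : {perm T}) (x y : T) :
  orthonormal_eigenbasis L lambda V -> graph_automorphism e p ->
  edge_derivative e lambda V (p x) (p y) = edge_derivative e lambda V x y.
Proof.
move=> V_basis p_aut.
(* The vertex automorphism is transported to a permutation of the matrix indices. *)
have s_inj : injective (fun j : 'I_#|T| => enum_rank (p (enum_val j))).
  by move=> i j /enum_rank_inj/perm_inj/enum_val_inj.
pose s := perm s_inj.
have sE z : s (enum_rank z) = enum_rank (p z) by rewrite permE enum_rankK.
have sL : row_perm s (col_perm s L) = L.
  apply/matrixP=> i j; rewrite -(enum_valK i) -(enum_valK j).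
  rewrite mxE mxE !sE !normalized_laplacianE p_aut (inj_eq perm_inj).
  by rewrite !degree_automorphism.
have PE z t : (V^T *m V) (enum_rank (p z)) (enum_rank (p t)) =
              (V^T *m V) (enum_rank z) (enum_rank t).
  rewrite -[in RHS](gram_col_perm sL V_basis) !mxE.
  by apply: eq_bigr => i _; rewrite !mxE !sE.
by rewrite !edge_derivativeE !PE !degree_automorphism.
Qed.

Lemma sum_edge_derivative (e_sym : symmetric e) (lambda : R) (k : nat)
    (V : 'M[R]_(k, #|T|)) :
  (forall x, 0 < degree e x)%N -> V *m L = lambda *: V ->
  \sum_x \sum_(y | e x y) edge_derivative e lambda V x y = 0.
Proof.
move=> d_gt0 VL; have d_neq0 x : d x != 0 by rewrite pnatr_eq0 -lt0n.
(* The weight [1 / d x] is counted once for each of the [d x] neighbours. *)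
have sum_nbr (f : T -> R) x : \sum_(y | e x y) f x / d x = f x.
  rewrite sumr_const -[LHS]mulr_natr (_ : #|_| = degree e x) ?divfK //.
  by apply: eq_card => y; rewrite inE.
rewrite /edge_derivative.
under eq_bigr => x _ do rewrite -mulr_sumr exchange_big.
rewrite -mulr_sumr exchange_big big1 ?mulr0 //= => i _.
pose v x := V i (enum_rank x).
under eq_bigr => x _.
  rewrite sumrB -!mulr_sumr big_split /= (sum_nbr (fun x => v x ^+ 2)).
  (* The factor [v x] leaves the inner sum, which the eigenvector equation then evaluates. *)
  under [X in _ - 2 * X]eq_bigr => y _ do rewrite -mulrA.
  rewrite -mulr_sumr (sum_neighbours_eigenvector e_sym _ _ VL) -/(v x).
  over.
rewrite sumrB -!mulr_sumr big_split /=.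
(* The squares at [y] are summed over [x] first; by symmetry of [e] they give the same total as the
   squares at [x]. *)
rewrite [X in _ * (_ + X) - _](exchange_big_dep predT) //=.
under [X in _ * (_ + X) - _]eq_bigr => y _.
  under eq_bigl => x do rewrite e_sym.
  rewrite (sum_nbr (fun x => v x ^+ 2)); over.
under [X in _ - 2 * X]eq_bigr => x _ do rewrite mulrCA -expr2.
by rewrite -mulr_sumr; ring.
Qed.

End Laplacian.

Lemma set2_eq (T : finType) (a b c d : T) :
  [set a; b] = [set c; d] -> a != b -> (a = c /\ b = d) \/ (a = d /\ b = c).
Proof.
move=> /setP eq_ab a_neq_b.
have := eq_ab a; have := eq_ab b; rewrite !inE !eqxx orbT /=.
move: a_neq_b; case: (a =P c) => [->|_]; case: (b =P d) => [->|_] //=; auto.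
- by rewrite orbF => + /esym/eqP bc _; rewrite bc eqxx.
- by move=> /eqP ab /esym da /esym ad; case: ab; rewrite (eqP ad).
by rewrite orbF => _ /esym/eqP-> /esym/eqP->; auto.
Qed.

Theorem theorem2p14 (R : rcfType) (T : finType) (e : rel T)
    (e_sym : symmetric e) (e_irr : irreflexive e)
    (card_T : (1 < #|T|)%N)
    (e_conn : graph_connected e)
    (e_trans : edge_transitive e)
    (lambda : R)
    (lambda_eig : eigenvalue (normalized_laplacian R e) lambda)
    (k : nat) (k_mult : k = multiplicity (normalized_laplacian R e) lambda)
    (V : 'M[R]_(k, #|T|))
    (V_basis : orthonormal_eigenbasis (normalized_laplacian R e) lambda V)
    (x y : T) (exy : e x y) :
  edge_derivative e lambda V x y = 0.
Proof.
have const z t : e z t ->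
    edge_derivative e lambda V z t = edge_derivative e lambda V x y.
  move=> ezt; have [p p_aut] := e_trans _ _ _ _ exy ezt.
  rewrite imsetU !imset_set1 => /set2_eq[].
  - by apply: contraTneq exy => /perm_inj->; rewrite e_irr.
  - by case=> <- <-; apply: edge_derivative_automorphism.
  (* Here the automorphism sends [x] to [t] and [y] to [z], so the ends are swapped first. *)
  case=> <- <-; rewrite edge_derivativeC.
  exact: edge_derivative_automorphism.
have d_gt0 z : (0 < degree e z)%N by apply: degree_gt0.
have VL : V *m normalized_laplacian R e = lambda *: V.
  by case: V_basis => _ /andP[/eigenspaceP].
have := sum_edge_derivative e_sym d_gt0 VL.
under eq_bigr => z _.
  under eq_bigr => t ezt do rewrite (const _ _ ezt).
  rewrite sumr_const -mulr_natr; over.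
(* The common value times the number of ordered edges is zero. Were that number zero, every
   neighbourhood would be empty, yet [y] is a neighbour of [x]. *)
rewrite -mulr_sumr => /eqP; rewrite mulf_eq0 => /orP[/eqP //|].
rewrite psumr_eq0 => [|z _]; last exact: ler0n.
move/allP/(_ x (mem_index_enum x)); rewrite pnatr_eq0 /= => /eqP/card0_eq/(_ y).
by rewrite unfold_in exy.
Qed.
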